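(* Let $G=H\bowtie K$ be the Zappa-Szép product of two groups $H$ and $K$. Then $\mathrm{End}(H\bowtie K)\simeq\mathcal{M}$ as monoids, where $\mathrm{End}(H\bowtie K)$ is the monoid of endomorphisms of $G$ under composition and $\mathcal{M}$ is the monoid of matrices of maps defined in the context.
   Context: $G=H\bowtie K$ means that $H,K$ are subgroups of the group $G$ with $G=HK$ and $H\cap K=\{1\}$ (internal Zappa-Szép product, identified with the external one). Every element of $G$ is uniquely $hk$ with $h\in H$, $k\in K$. For $k\in K,h\in H$, write $kh=(k\cdot h)\,k^{h}$ with $k\cdot h\in H$ and $k^{h}\in K$; this defines the mutual actions $(k,h)\mapsto k\cdot h\in H$ and $(k,h)\mapsto k^{h}\in K$. Notation for maps between groups $U,V,W$: for $\phi,\psi:U\to V$ and $\eta:V\to W$, $(\phi+\psi)(u)=\phi(u)\psi(u)$ and $\eta\phi(u)=\eta(\phi(u))$. For $\phi:U\to K$, $\psi:U\to H$: $(\phi\cdot\psi)(u)=\phi(u)\cdot\psi(u)$ and $(\phi^{\psi})(u)=\phi(u)^{\psi(u)}$. $\mathcal{M}$ is the set of matrices $\begin{pmatrix}\alpha&\beta\\ \gamma&\delta\end{pmatrix}$ of maps $\alpha:H\to H$, $\beta:K\to H$, $\gamma:H\to K$, $\delta:K\to K$ such that for all $h,h'\in H$, $k,k'\in K$: (i) $\alpha(hh')=\alpha(h)(\gamma(h)\cdot\alpha(h'))$; (ii) $\gamma(hh')=\gamma(h)^{\alpha(h')}\gamma(h')$; (iii) $\beta(kk')=\beta(k)(\delta(k)\cdot\beta(k'))$;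 (iv) $\delta(kk')=\delta(k)^{\beta(k')}\delta(k')$; (v) $\beta(k)(\delta(k)\cdot\alpha(h))=\alpha(k\cdot h)(\gamma(k\cdot h)\cdot\beta(k^{h}))$; (vi) $\delta(k)^{\alpha(h)}\gamma(h)=\gamma(k\cdot h)^{\beta(k^{h})}\delta(k^{h})$. The monoid operation on $\mathcal{M}$ is $$\begin{pmatrix}\alpha'&\beta'\\ \gamma'&\delta'\end{pmatrix}\begin{pmatrix}\alpha&\beta\\ \gamma&\delta\end{pmatrix}=\begin{pmatrix}\alpha'\alpha+(\gamma'\alpha\cdot\beta'\gamma)&\alpha'\beta+(\gamma'\beta\cdot\beta'\delta)\\ (\gamma'\alpha)^{\beta'\gamma}+\delta'\gamma&(\gamma'\beta)^{\beta'\delta}+\delta'\delta\end{pmatrix},$$ with identity element $\begin{pmatrix}1&0\\0&1\end{pmatrix}$, where $1$ is the identity map and $0$ the trivial map. *)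

(* Defs.v *)
From HB Require Import structures.
From mathcomp Require Import all_boot.
From mathcomp Require Import boolp.

Set Implicit Arguments.
Unset Strict Implicit.
Unset Printing Implicit Defensive.

Local Open Scope group_scope.

Definition End (G : groupType) : Type := UMagmaMorphism.type G G.

Section EndMonoid.
Variable G : groupType.

Definition End_fun (f : End G) : G -> G := UMagmaMorphism.sort f.

Definition End_comp (f g : End G) : End G :=
  (End_fun f \o End_fun g : UMagmaMorphism.type G G).

Definition End_id : End G := (@idfun G : UMagmaMorphism.type G G).

Lemma End_eqP (f g : End G) : End_fun f =1 End_fun g -> f = g.
Proof.
case: f g => [f [[f1] [fM]]] [g [[g1] [gM]]] fg.
have {}fg : f = g by apply: funext; exact: fg.
case: _ / fg in g1 gM *.
by rewrite (Prop_irrelevance f1 g1) (Prop_irrelevance fM gM).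
Qed.

HB.instance Definition _ := gen_eqMixin (End G).
HB.instance Definition _ := gen_choiceMixin (End G).

Lemma End_compA : associative End_comp.
Proof. by move=> f g h; apply: End_eqP. Qed.

Lemma End_comp1f : left_id End_id End_comp.
Proof. by move=> f; apply: End_eqP. Qed.

Lemma End_compf1 : right_id End_id End_comp.
Proof. by move=> f; apply: End_eqP. Qed.

HB.instance Definition _ :=
  isMonoid.Build (End G) End_compA End_comp1f End_compf1.

End EndMonoid.

Definition zappa_szep (G : groupType) (P Q : pred G)
    (H : subGroupType P) (K : subGroupType Q) : Prop :=
  (forall g : G, exists (h : H) (k : K), g = val h * val k) /\
  (forall g : G, g \in P -> g \in Q -> g = 1).

Section ZappaSzep.
Variables (G : groupType) (P Q : pred G).
Variables (H : subGroupType P) (K : subGroupType Q).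
Variable GHK : zappa_szep H K.

Lemma zs_split_subproof (g : G) :
  exists u : H * K, val u.1 * val u.2 == g.
Proof. by have [h [k ->]] := GHK.1 g; exists (h, k). Qed.

Definition zs_split (g : G) : H * K := xchoose (zs_split_subproof g).

(* zs_lact k h is the element of H written k . h, and zs_ract k h is the element
   of K written k ^ h (not a conjugate): kh = (k . h) (k ^ h), see zs_actE. *)
Definition zs_lact (k : K) (h : H) : H := (zs_split (val k * val h)).1.
Definition zs_ract (k : K) (h : H) : K := (zs_split (val k * val h)).2.

Lemma zs_splitK (g : G) : val (zs_split g).1 * val (zs_split g).2 = g.
Proof. exact/eqP/(xchooseP (zs_split_subproof g)). Qed.

Lemma zs_actE (k : K) (h : H) :
  val k * val h = val (zs_lact k h) * val (zs_ract k h).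
Proof. by rewrite zs_splitK. Qed.

Lemma zs_inj (h h' : H) (k k' : K) :
  val h * val k = val h' * val k' -> h = h' /\ k = k'.
Proof.
move=> e.
have e1 : (val h')^-1 * val h = val k' * (val k)^-1.
  by apply: (mulIg (val k)); rewrite mulgVK -mulgA e mulKg.
have e2 : val (h'^-1 * h) = val (k' * k^-1) :> G.
  by rewrite !gmulfM !gmulfV.
have e0 : val (h'^-1 * h) = 1 :> G.
  by apply: GHK.2; [exact: valP | rewrite e2; exact: valP].
split; apply: val_inj.
  by apply: (mulgI (val h')^-1); rewrite mulVg -e0 gmulfM gmulfV.
by apply: (mulIg (val k)^-1); rewrite mulgV -e0 e2 gmulfM gmulfV.
Qed.

Lemma zs_splitE (h : H) (k : K) : zs_split (val h * val k) = (h, k).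
Proof.
have := zs_splitK (val h * val k).
by case: (zs_split _) => h' k' /= /zs_inj[-> ->].
Qed.

(* The matrix with rows (alpha, beta) and (gamma, delta). *)
Record zsmx : Type := ZSMx {
  zs_alpha : H -> H; zs_beta : K -> H;
  zs_gamma : H -> K; zs_delta : K -> K }.

Record zsmx_cond (A : zsmx) : Prop := ZSMxCond {
  zs_alphaM : forall h h' : H, zs_alpha A (h * h') =
    zs_alpha A h * zs_lact (zs_gamma A h) (zs_alpha A h');
  zs_gammaM : forall h h' : H, zs_gamma A (h * h') =
    zs_ract (zs_gamma A h) (zs_alpha A h') * zs_gamma A h';
  zs_betaM : forall k k' : K, zs_beta A (k * k') =
    zs_beta A k * zs_lact (zs_delta A k) (zs_beta A k');
  zs_deltaM : forall k k' : K, zs_delta A (k * k') =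
    zs_ract (zs_delta A k) (zs_beta A k') * zs_delta A k';
  zs_lact_compat : forall (k : K) (h : H),
    zs_beta A k * zs_lact (zs_delta A k) (zs_alpha A h) =
    zs_alpha A (zs_lact k h) *
      zs_lact (zs_gamma A (zs_lact k h)) (zs_beta A (zs_ract k h));
  zs_ract_compat : forall (k : K) (h : H),
    zs_ract (zs_delta A k) (zs_alpha A h) * zs_gamma A h =
    zs_ract (zs_gamma A (zs_lact k h)) (zs_beta A (zs_ract k h)) *
      zs_delta A (zs_ract k h) }.

Definition zsmx_mul (A' A : zsmx) : zsmx :=
  let: ZSMx a' b' c' d' := A' in
  let: ZSMx a b c d := A in
  ZSMx (fun h => a' (a h) * zs_lact (c' (a h)) (b' (c h)))
       (fun k => a' (b k) * zs_lact (c' (b k)) (b' (d k)))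
       (fun h => zs_ract (c' (a h)) (b' (c h)) * d' (c h))
       (fun k => zs_ract (c' (b k)) (b' (d k)) * d' (d k)).

Definition zsmx_one : zsmx :=
  ZSMx (fun h => h) (fun=> 1) (fun=> 1) (fun k => k).

Record zsmonoid : Type := ZSMonoid {
  zsm_mx :> zsmx;
  zsm_cond : zsmx_cond zsm_mx }.

Lemma zsm_eq (A B : zsmonoid) : zsm_mx A = zsm_mx B -> A = B.
Proof.
case: A B => A cA [B cB] /= eAB; case: _ / eAB in cB *.
by rewrite (Prop_irrelevance cA cB).
Qed.

(* Closure and the monoid laws are obtained by letting a matrix act on G via
   hk |-> alpha(h) gamma(h) beta(k) delta(k). *)
Definition zsmx_fun (A : zsmx) (g : G) : G :=
  let: ZSMx a b c d := A in
  let: (h, k) := zs_split g in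
  val (a h) * val (c h) * (val (b k) * val (d k)).

Definition fun_zsmx (f : G -> G) : zsmx :=
  ZSMx (fun h => (zs_split (f (val h))).1) (fun k => (zs_split (f (val k))).1)
       (fun h => (zs_split (f (val h))).2) (fun k => (zs_split (f (val k))).2).

Lemma zs_splitM (h h' : H) (k k' : K) :
  val h * val k * (val h' * val k') =
  val (h * zs_lact k h') * val (zs_ract k h' * k').
Proof. by rewrite !gmulfM !mulgA -(mulgA (val h)) zs_actE !mulgA. Qed.

Lemma zs_split_H (h : H) : zs_split (val h) = (h, 1).
Proof. by rewrite -zs_splitE gmulf1 mulg1. Qed.

Lemma zs_split_K (k : K) : zs_split (val k) = (1, k).
Proof. by rewrite -zs_splitE gmulf1 mul1g. Qed.

Lemma fun_zsmx_cond (f : G -> G) :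
  {morph f : x y / x * y} -> zsmx_cond (fun_zsmx f).
Proof.
move=> fM.
have key (x y x' y' : G) : x * y = x' * y' ->
    (zs_split (f x)).1 * zs_lact (zs_split (f x)).2 (zs_split (f y)).1 =
    (zs_split (f x')).1 * zs_lact (zs_split (f x')).2 (zs_split (f y')).1 /\
    zs_ract (zs_split (f x)).2 (zs_split (f y)).1 * (zs_split (f y)).2 =
    zs_ract (zs_split (f x')).2 (zs_split (f y')).1 * (zs_split (f y')).2.
  by move=> e; apply: zs_inj; rewrite -!zs_splitM !zs_splitK -!fM e.
have keyM (x y : G) : zs_split (f (x * y)) =
    ((zs_split (f x)).1 * zs_lact (zs_split (f x)).2 (zs_split (f y)).1,
     zs_ract (zs_split (f x)).2 (zs_split (f y)).1 * (zs_split (f y)).2).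
  by rewrite -zs_splitE -zs_splitM !zs_splitK fM.
split=> x y /=;
  rewrite ?gmulfM ?keyM //;
  by have [] := key _ _ _ _ (zs_actE x y).
Qed.

Lemma zsmx_fun_cond (A : zsmx) :
  zsmx_cond A -> {morph zsmx_fun A : x y / x * y}.
Proof.
case: A => a b c d [/= aM cM bM dM abP cdP].
pose u h : G := val (a h) * val (c h); pose v k : G := val (b k) * val (d k).
have uM h h' : u (h * h') = u h * u h' by rewrite /u zs_splitM aM cM.
have vM k k' : v (k * k') = v k * v k' by rewrite /v zs_splitM bM dM.
have vu k h : v k * u h = u (zs_lact k h) * v (zs_ract k h).
  by rewrite /u /v !zs_splitM abP cdP.
have uvE h k : zsmx_fun (ZSMx a b c d) (val h * val k) = u h * v k.
  by rewrite /zsmx_fun zs_splitE.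
clearbody u v => x y; rewrite -(zs_splitK x) -(zs_splitK y).
case: (zs_split x) (zs_split y) => h k [h' k'].
rewrite zs_splitM !uvE uM vM -!mulgA.
by congr (_ * _); rewrite !mulgA vu.
Qed.

Lemma zsmx_cond1 (A : zsmx) : zsmx_cond A ->
  [/\ zs_alpha A 1 = 1, zs_beta A 1 = 1, zs_gamma A 1 = 1 & zs_delta A 1 = 1].
Proof.
case: A => a b c d [/= aM cM bM dM _ _].
have sq1 (x : G) : x = x * x -> x = 1 by move=> e; apply: (mulgI x); rewrite mulg1 -e.
have e : val (a 1) * val (c 1) = 1 :> G.
  by apply: sq1; rewrite zs_splitM -aM -cM !mulg1.
have e' : val (b 1) * val (d 1) = 1 :> G.
  by apply: sq1; rewrite zs_splitM -bM -dM !mulg1.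
have e1 : val (1 : H) * val (1 : K) = 1 :> G by rewrite !gmulf1 mulg1.
move: e e'; rewrite -{1}e1 => /zs_inj[-> ->].
by rewrite -e1 => /zs_inj[-> ->].
Qed.

Lemma zsmx_funK (A : zsmx) : zsmx_cond A -> fun_zsmx (zsmx_fun A) = A.
Proof.
move=> /zsmx_cond1; case: A => a b c d /= [a1 b1 c1 d1].
by congr ZSMx; apply: funext => x; rewrite /= ?(zs_split_H, zs_split_K)
  ?a1 ?b1 ?c1 ?d1 !gmulf1 ?mulg1 ?mul1g zs_splitE.
Qed.

Lemma zsmx_mulE (A' A : zsmx) : zsmx_cond A' -> zsmx_cond A ->
  zsmx_mul A' A = fun_zsmx (zsmx_fun A' \o zsmx_fun A).
Proof.
move=> _ /zsmx_cond1; case: A' A => a' b' c' d' [a b c d] /= [a1 b1 c1 d1].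
by congr ZSMx; apply: funext => x; rewrite /= ?(zs_split_H, zs_split_K)
  ?a1 ?b1 ?c1 ?d1 !gmulf1 ?mulg1 ?mul1g zs_splitE zs_splitM zs_splitE.
Qed.

Lemma zsmx_oneE : zsmx_one = fun_zsmx idfun.
Proof.
by congr ZSMx; apply: funext => x /=; rewrite ?(zs_split_H, zs_split_K).
Qed.

Lemma fun_zsmxK (f : G -> G) :
  {morph f : x y / x * y} -> zsmx_fun (fun_zsmx f) =1 f.
Proof.
move=> fM g /=; rewrite -{2}(zs_splitK g) fM.
by case: (zs_split g) => h k; rewrite !zs_splitK.
Qed.

Lemma zsmx_mul_cond (A' A : zsmx) :
  zsmx_cond A' -> zsmx_cond A -> zsmx_cond (zsmx_mul A' A).
Proof.
move=> cA' cA; rewrite zsmx_mulE //; apply: fun_zsmx_cond => x y /=.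
by rewrite !zsmx_fun_cond.
Qed.

Lemma zsmx_one_cond : zsmx_cond zsmx_one.
Proof. by rewrite zsmx_oneE; apply: fun_zsmx_cond. Qed.

Definition zsm_mul (A' A : zsmonoid) : zsmonoid :=
  ZSMonoid (zsmx_mul_cond (zsm_cond A') (zsm_cond A)).

Definition zsm_one : zsmonoid := ZSMonoid zsmx_one_cond.

Lemma zsm_fun_inj (A B : zsmonoid) : zsmx_fun A =1 zsmx_fun B -> A = B.
Proof.
move=> /funext AB; apply: zsm_eq.
by rewrite -(zsmx_funK (zsm_cond A)) AB zsmx_funK //; apply: zsm_cond.
Qed.

Lemma zsm_fun_mul (A' A : zsmonoid) :
  zsmx_fun (zsm_mul A' A) =1 zsmx_fun A' \o zsmx_fun A.
Proof.
rewrite /= zsmx_mulE; [|exact: zsm_cond..].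
by apply: fun_zsmxK => x y /=; rewrite !zsmx_fun_cond //; exact: zsm_cond.
Qed.

Lemma zsm_fun_one : zsmx_fun zsm_one =1 idfun.
Proof. by rewrite [zsm_mx _]zsmx_oneE; apply: fun_zsmxK. Qed.

HB.instance Definition _ := gen_eqMixin zsmonoid.
HB.instance Definition _ := gen_choiceMixin zsmonoid.

Lemma zsm_mulA : associative zsm_mul.
Proof.
move=> A B C; apply: zsm_fun_inj => g.
by do ![rewrite zsm_fun_mul /comp].
Qed.

Lemma zsm_mul1m : left_id zsm_one zsm_mul.
Proof.
by move=> A; apply: zsm_fun_inj => g; rewrite zsm_fun_mul /comp zsm_fun_one.
Qed.

Lemma zsm_mulm1 : right_id zsm_one zsm_mul.
Proof.
by move=> A; apply: zsm_fun_inj => g; rewrite zsm_fun_mul /comp zsm_fun_one.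
Qed.

HB.instance Definition _ :=
  isMonoid.Build zsmonoid zsm_mulA zsm_mul1m zsm_mulm1.

End ZappaSzep.

(* Main.v *)
From HB Require Import structures.
Require Import Defs.
From mathcomp Require Import all_boot.

(** Write u and v for the restrictions of an endomorphism f of G to H and K.
    Since each g in G is uniquely hk, f is determined by u and v through
    f(hk) = u(h) v(k), and u and v are in turn determined by the H- and
    K-components of their values, i.e. by four maps: u(h) = alpha(h) gamma(h)
    and v(k) = beta(k) delta(k).  Conversely, such u and v glue to an
    endomorphism exactly when both are morphisms, which amounts to the laws for
    alpha(hh'), gamma(hh'), beta(kk') and delta(kk'), and when they respect the
    straightening rule kh = (k.h)(k^h), i.e. v(k) u(h) = u(k.h) v(k^h), which
    amounts to the two compatibility laws: in each case one compares
    components, using (hk)(h'k') = (h (k.h')) (k^h' k').  This is the content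
    of [fun_zsmx_cond] and [zsmx_fun_cond], and [zsmx_funK] and [fun_zsmxK] say
    that the two passages are mutually inverse.

    A matrix is thus a faithful name for the function it defines on G, so any
    identity between matrices can be tested on these functions
    ([zsm_fun_inj]); there the matrix product is composition
    ([zsm_fun_mul]), and multiplicativity of the encoding becomes a
    tautology. *)

Section EndomorphismMatrices.
Context {G : groupType} {P Q : pred G}.
Context {H : subGroupType P} {K : subGroupType Q} (GHK : zappa_szep H K).
Local Open Scope group_scope.

Lemma End_funM (f : End G) : {morph End_fun f : x y / x * y}.
Proof. exact: gmulfM. Qed.

Definition zsm_of_End (f : End G) : zsmonoid GHK :=
  ZSMonoid (fun_zsmx_cond GHK (End_funM f)).

Lemma zsm_fun_monoid_morphism (A : zsmonoid GHK) :
  monoid_morphism (zsmx_fun GHK A).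
Proof.
have fM := zsmx_fun_cond (zsm_cond A); split=> //.
(* In a group, an idempotent value f(1) = f(1) f(1) must be 1. *)
by apply: (mulgI (zsmx_fun GHK A 1)); rewrite -fM !mulg1.
Qed.

HB.instance Definition _ (A : zsmonoid GHK) :=
  isUMagmaMorphism.Build G G (zsmx_fun GHK A) (zsm_fun_monoid_morphism A).

Definition End_of_zsm (A : zsmonoid GHK) : End G :=
  (zsmx_fun GHK A : UMagmaMorphism.type G G).

Lemma zsm_of_EndK : cancel zsm_of_End End_of_zsm.
Proof. by move=> f; apply: End_eqP; apply: fun_zsmxK (End_funM f). Qed.

Lemma End_of_zsmK : cancel End_of_zsm zsm_of_End.
Proof. by move=> A; apply: zsm_eq; apply: zsmx_funK (zsm_cond A). Qed.

Lemma zsm_of_End_fun (f : End G) : zsmx_fun GHK (zsm_of_End f) =1 End_fun f.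
Proof. exact: fun_zsmxK (End_funM f). Qed.

Lemma zsm_of_End_monoid_morphism : monoid_morphism zsm_of_End.
Proof.
split=> [|f f']; apply: zsm_fun_inj => g.
  by rewrite zsm_of_End_fun zsm_fun_one.
by rewrite zsm_fun_mul /comp !zsm_of_End_fun.
Qed.

End EndomorphismMatrices.

Theorem theorem2p1 (G : groupType) (P Q : pred G)
    (H : subGroupType P) (K : subGroupType Q) (GHK : zappa_szep H K) :
  exists f : End G -> zsmonoid GHK, bijective f /\ monoid_morphism f.
Proof.
exists (zsm_of_End GHK); split; last exact: zsm_of_End_monoid_morphism.
exact: Bijective (zsm_of_EndK GHK) (End_of_zsmK GHK).
Qed.
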